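(* Let $k$ be a field of characteristic zero, let $n\geq 2$, let $R=k[x_1,\ldots,x_{2n-2},w,u]$ be the standard graded polynomial ring in $2n$ variables, and let $$f=wuq,\qquad q=\prod_{i=1}^{n-1}(x_{2i-1}u-x_{2i}w).$$ Then: (i) $f$ is a linear free divisor; (ii) The $2n\times(2n-1)$ matrix $$\psi_n=\left[\begin{array}{cc|c|cc|c} w&(n+1)x_1&\cdots&0&0&0\\ u&(n+1)x_2&\cdots&0&0&(n+1)x_2\\ \hline \vdots&\vdots&\ddots&\vdots&\vdots&\vdots\\ \hline 0&0&\cdots&w&(n+1)x_{2n-3}&0\\ 0&0&\cdots&u&(n+1)x_{2n-2}&(n+1)x_{2n-2}\\ \hline 0&-w&\cdots&0&-w&-nw\\ 0&-u&\cdots&0&-u&u \end{array}\right]$$ is a syzygy matrix of $J_f$ (with respect to the generators $f_{x_1},\ldots,f_{x_{2n-2}},f_w,f_u$, in this order). Thus a free basis of $T_{R/k}(f)$ is $\{\theta_1,\ldots,\theta_{2n-1},\varepsilon_{2n}\}$, where the $\theta_i$'s are the derivations corresponding to the columns of $\psi_n$; (iii) ${\rm reg}\,{\rm Der}_k(R/(f))=2(n-1)$.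
   Context: Explicitly, the columns of $\psi_n$ (rows indexed by $x_1,\ldots,x_{2n-2},w,u$) are: for each $1\le i\le n-1$, the column with entry $w$ in row $x_{2i-1}$, $u$ in row $x_{2i}$ and $0$ elsewhere; for each $1\le i\le n-1$, the column with entries $(n+1)x_{2i-1}$ in row $x_{2i-1}$, $(n+1)x_{2i}$ in row $x_{2i}$, $-w$ in row $w$, $-u$ in row $u$ and $0$ elsewhere; and a last column with entries $0$ in rows $x_{2i-1}$, $(n+1)x_{2i}$ in rows $x_{2i}$ ($1\le i\le n-1$), $-nw$ in row $w$, $u$ in row $u$. A column $(g_1,\ldots,g_{2n})^t$ corresponds to the derivation $\sum_i g_i\,\partial/\partial X_i$, where $(X_1,\ldots,X_{2n})=(x_1,\ldots,x_{2n-2},w,u)$. The Euler derivation is $\varepsilon_{2n}=\sum_i X_i\,\partial/\partial X_i$. A syzygy matrix of $J_f$ is a matrix whose columns minimally generate the module of syzygies of the given generators. Polynomials $f$ under consideration are non-zero, homogeneous, reduced, contained in $R_+^2$ ($R_+$ the homogeneous maximal ideal), with $k$-linearly independent partial derivatives (standing convention). $J_f$ is the ideal generated by the partial derivatives of $f$. $T_{R/k}(f)=\{\theta\in{\rm Der}_k(R):\theta(f)\in(f)\}$ is the module of logarithmic derivations. $f$ is a free divisor if $T_{R/k}(f)$ is a free $R$-module; it is a linear free divisor if moreover $J_f$ is linearly presented (with $N$ the number of variables, $J_f$ has a minimal graded free resolution $0\to R(-N)^{N-1}\to R(-N+1)^N\to J_f\to 0$). ${\rm Der}_k(R)$ is graded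 so that each partial derivation has degree $-1$; $T_{R/k}(f)$ has the induced grading, and ${\rm Der}_k(R/(f))=T_{R/k}(f)/f{\rm Der}_k(R)$ the quotient grading. For a finitely generated graded $R$-module $E$ with minimal graded free resolution with terms $F_i=\bigoplus_jR(-a_{i,j})$, the Castelnuovo-Mumford regularity is ${\rm reg}\,E=\max\{a_{i,j}-i\}$. *)

(* Defs.v *)
From mathcomp Require Export all_boot all_order all_algebra.
From mathcomp Require Export mpoly.
(* [functions] provides the [lmodType] structure on the function space
   [R -> R^o], in which derivations live. *)
From mathcomp Require Export functions.

Set Implicit Arguments.
Unset Strict Implicit.
Unset Printing Implicit Defensive.

Import GRing.Theory.
Local Open Scope ring_scope.

Section Generation.

Variables (A : nzRingType) (V : lmodType A) (M : V -> Prop).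
Variables (I : finType) (e : I -> V).

Definition generates_with (S : {set I}) : Prop :=
  forall v, M v <-> exists c : I -> A, v = \sum_(i in S) c i *: e i.

Definition generates : Prop := generates_with [set: I].

Definition minimally_generates : Prop :=
  generates /\
  forall S : {set I}, S \proper [set: I] -> ~ generates_with S.

Definition free_basis : Prop :=
  generates /\
  forall c : I -> A, \sum_i c i *: e i = 0 -> forall i, c i = 0.

End Generation.

(* For the noetherian modules considered here a basis is finite. *)
Definition free_module (A : nzRingType) (V : lmodType A) (M : V -> Prop) : Prop :=
  exists (I : finType) (e : I -> V), free_basis M e.

Section Graded.

Variables (k : fieldType) (N : nat).
Local Notation R := {mpoly k[N]}.

Definition homogeneous (d : int) (p : R) : Prop :=
  match d with
  | Posz m => p \is m.-homog
  | Negz _ => p = 0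
  end.

(* A graded module presented as a subquotient [gm_num / gm_den] of an ambient
   module; [gm_deg d v] says that [v] is homogeneous of degree [d]. *)
Record graded_module := GradedModule {
  gm_ambient : lmodType R;
  gm_num : gm_ambient -> Prop;
  gm_den : gm_ambient -> Prop;
  gm_deg : int -> gm_ambient -> Prop
}.

(* The free modules F_i = (+)_j R(- fc_shift i j), j < fc_rank i, written as
   columns, with the matrices of the differentials F_(i+1) -> F_i. *)
Record free_complex := FreeComplex {
  fc_rank : nat -> nat;
  fc_shift : forall i, 'I_(fc_rank i) -> int;
  fc_diff : forall i, 'M[R]_(fc_rank i, fc_rank i.+1)
}.

(* [e] lists representatives of the images in E of the basis of F_0; the
   entry (p, q) of a differential has degree
   [fc_shift i.+1 q - fc_shift i p], so that the differentials preserve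
   degrees, and has zero constant term (minimality). *)
Record min_graded_free_resolution (E : graded_module) (F : free_complex)
    (e : 'I_(fc_rank F 0) -> gm_ambient E) : Prop := MinGradedFreeResolution {
  mgfr_aug_mem : forall p, gm_num (e p);
  mgfr_aug_deg : forall p, gm_deg (fc_shift p) (e p);
  mgfr_aug_surj : forall v, gm_num v ->
    exists c : 'cV[R]_(fc_rank F 0),
      gm_den (v - \sum_p c p 0 *: e p);
  mgfr_exact0 : forall c : 'cV[R]_(fc_rank F 0),
    gm_den (\sum_p c p 0 *: e p) <-> exists b, c = fc_diff F 0 *m b;
  mgfr_exact : forall i (c : 'cV[R]_(fc_rank F i.+1)),
    fc_diff F i *m c = 0 <-> exists b, c = fc_diff F i.+1 *m b;
  mgfr_diff_deg : forall i p q,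
    homogeneous (fc_shift q - fc_shift p) (fc_diff F i p q);
  mgfr_minimal : forall i p q, (fc_diff F i p q)@_0%MM = 0
}.

Definition regularity_is (E : graded_module) (r : int) : Prop :=
  exists (F : free_complex) (e : 'I_(fc_rank F 0) -> gm_ambient E),
    [/\ min_graded_free_resolution e,
        (exists i (j : 'I_(fc_rank F i)), fc_shift j - i%:Z = r)
      & forall i (j : 'I_(fc_rank F i)), (fc_shift j - i%:Z <= r)%R].

End Graded.

Section Divisors.

Variables (k : fieldType) (N : nat).
Local Notation R := {mpoly k[N]}.

Definition principal (f p : R) : Prop := exists h, p = h * f.

Definition gradient (f : R) : 'rV[R]_N := \row_i f^`M(i).

Definition jacobian_ideal (f : R) (p : R^o) : Prop :=
  exists c : 'I_N -> R, p = \sum_i c i * f^`M(i).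

Definition jacobian_module (f : R) : graded_module k N :=
  @GradedModule k N R^o (jacobian_ideal f) (fun p => p = 0) (@homogeneous k N).

Definition is_derivation (D : R -> R^o) : Prop :=
  (forall (a : k) (p q : R), D (a *: p + q) = a *: (D p : R) + D q) /\
  (forall p q : R, D (p * q) = D p * q + p * D q).

Definition log_derivation (f : R) (D : R -> R^o) : Prop :=
  is_derivation D /\ principal f (D f).

(* D = \sum_i D(X_i) d/dX_i, where d/dX_i has degree -1. *)
Definition derivation_homog (d : int) (D : R -> R^o) : Prop :=
  forall i, homogeneous (d + 1) (D 'X_i).

Definition derivations_quotient (f : R) : graded_module k N :=
  @GradedModule k N (R -> R^o) (log_derivation f)
    (fun D => exists2 D' : R -> R^o, is_derivation D' & D = f *: D')
    derivation_homog.

Definition derivation_of (g : 'cV[R]_N) : R -> R^o :=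
  fun p => \sum_i g i 0 * p^`M(i).

Definition euler_derivation : R -> R^o := derivation_of (\col_i 'X_i).

(* The conventions under which free divisors are considered: f is non-zero,
   homogeneous, reduced, in the square of the irrelevant ideal, and its partial
   derivatives are linearly independent over k. *)
Record admissible (f : R) : Prop := Admissible {
  adm_neq0 : f != 0;
  adm_homog : exists d : nat, f \is d.-homog;
  adm_reduced : forall (p : R) (m : nat), principal f (p ^+ m) -> principal f p;
  adm_sqr : exists c : 'I_N -> 'I_N -> R,
    f = \sum_i \sum_j c i j * ('X_i * 'X_j);
  adm_indep : forall c : 'I_N -> k,
    \sum_i c i *: f^`M(i) = 0 -> forall i, c i = 0
}.

Definition free_divisor (f : R) : Prop :=
  admissible f /\ free_module (log_derivation f).

(* J_f has a minimal graded free resolution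
   0 -> R(-N)^(N-1) -> R(-N+1)^N -> J_f -> 0. *)
Definition linearly_presented_jacobian (f : R) : Prop :=
  exists (F : free_complex k N)
         (e : 'I_(fc_rank F 0) -> gm_ambient (jacobian_module f)),
    [/\ min_graded_free_resolution e,
        fc_rank F 0 = N /\ (forall j : 'I_(fc_rank F 0), fc_shift j = N%:Z - 1),
        fc_rank F 1 = N.-1 /\ (forall j : 'I_(fc_rank F 1), fc_shift j = N%:Z)
      & forall i, (2 <= i)%N -> fc_rank F i = 0%N].

Definition linear_free_divisor (f : R) : Prop :=
  free_divisor f /\ linearly_presented_jacobian f.

Definition syzygy_matrix (p q : nat) (g : 'rV[R]_p) (A : 'M[R]_(p, q)) : Prop :=
  minimally_generates (fun v : 'cV[R]_p => g *m v = 0) (fun j => col j A).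

End Divisors.

Section Family.

Variables (k : fieldType) (n : nat).
Local Notation R := {mpoly k[2 * n]}.

(* The variable with 0-based index j among (x_1, ..., x_(2n-2), w, u); the
   value 0 outside of the range is never used when n >= 1. *)
Definition Xvar (j : nat) : R := if insub j is Some i then 'X_i else 0.

(* 1-based, as in x_1, ..., x_(2n-2) *)
Definition xvar (j : nat) : R := Xvar j.-1.
Definition wvar : R := Xvar (2 * n - 2).
Definition uvar : R := Xvar (2 * n - 1).

Definition qpoly : R :=
  \prod_(1 <= i < n) (xvar (2 * i - 1) * uvar - xvar (2 * i) * wvar).

Definition fpoly : R := wvar * uvar * qpoly.

(* Rows and columns are 0-based: for 1 <= i <= n-1, the rows of x_(2i-1) and
   x_(2i) are 2i-2 and 2i-1, and the two columns of the i-th block are again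
   2i-2 and 2i-1; the last column is 2n-2. *)
Definition psi : 'M[R]_(2 * n, (2 * n).-1) :=
  \matrix_(r, c)
    if c == (2 * n - 2)%N :> nat then
      if r == (2 * n - 2)%N :> nat then - (n%:R * wvar)
      else if r == (2 * n - 1)%N :> nat then uvar
      else if odd r then n.+1%:R * 'X_r
      else 0
    else if odd c then
      if (2 * n - 2 <= r)%N then - 'X_r
      else if r./2 == c./2 then n.+1%:R * 'X_r
      else 0
    else
      if r == c :> nat then wvar
      else if r == c.+1 :> nat then uvar
      else 0.

Definition theta (c : 'I_(2 * n).-1) : R -> R^o := derivation_of (col c psi).

(* theta_1, ..., theta_(2n-1) together with the Euler derivation *)
Definition theta_euler (o : option 'I_(2 * n).-1) : R -> R^o :=
  if o is Some c then theta c else @euler_derivation k (2 * n).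

End Family.

(* Main.v *)
From HB Require Import structures.
Require Import Defs.
From mathcomp Require Import fraction boolp zify ring.
Import GRing.Theory.
Local Open Scope ring_scope.

Set Implicit Arguments.
Unset Strict Implicit.
Unset Printing Implicit Defensive.

(** Write x_t, y_t (t < n - 1) for the two variables of a pair and
    q_t = x_t u - y_t w for the corresponding factor of f.

    The factors w, u, q_t of f are pairwise non-associated primes, so by the
    Leibniz rule a derivation D maps f into (f) exactly when it maps each factor
    into the ideal of that factor.  For the variables this reads D w = a w and
    D u = b u.  With D q_t = c_t q_t one gets
      u (D x_t + (b - c_t) x_t) = w (D y_t + (a - c_t) y_t),
    so both sides are a multiple d_t u w, and
      D x_t = (c_t - b) x_t + d_t w,   D y_t = (c_t - a) y_t + d_t u.
    Hence the logarithmic derivations are freely parametrised by a, b and the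
    c_t, d_t ([log_coordinates_exist]), and D f = (a + b + \sum_t c_t) f
    ([log_coordinates_fpoly]).  The columns of psi and the Euler derivation are
    related to these parameters by a linear substitution that can be inverted as
    soon as n + 1 and 2 n are invertible in k ([combination_of_coordinates],
    [combination_inj]): this gives the free basis of T(f).  A combination of it
    with coefficient e on the Euler derivation sends f to 2 n e f
    ([combination_fpoly]), so the syzygies of the partial derivatives are the
    combinations of the columns of psi alone ([syzygyP]).  Since psi is injective
    with linear entries, it is the only differential of a linear resolution of
    J_f, and minimality of the system of generators is a consequence of freeness.

    For the regularity, let B be the square matrix whose columns are the basis of
    T(f).  Each f d/dX_i is logarithmic, so B M = f for some matrix M, and M has
    entries of degree 2 n - 1 because B is injective with linear entries
    ([fpoly_adjugate]).  In the basis of T(f) the submodule f Der(R) is the image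
    of the injective map M, which yields the minimal resolution
      0 -> R(-(2 n - 1))^(2 n) -> R^(2 n) -> Der(R/(f)) -> 0
    and the regularity max (0, 2 n - 2).

    Primality of q_t is obtained by showing that (q_t) is the kernel of a ring
    morphism to the field of fractions, the substitution of y_t w / u for x_t
    ([subst_var_kernel]). *)

Local Notation "x %:F" := (@FracField.tofrac _ x).

(** * Polynomials, derivations and degrees *)

Section Polynomials.
Variables (k : fieldType) (N : nat).
Local Notation R := {mpoly k[N]}.
Implicit Types (p q r s g : R) (D : R -> R^o).

Lemma mpoly_generated_ind (P : R -> Prop) :
    (forall c, P c%:MP) -> (forall i, P 'X_i) ->
    (forall p q, P p -> P q -> P (p + q)) ->
    (forall p q, P p -> P q -> P (p * q)) ->
  forall p, P p.
Proof.
move=> PC PX PD PM p; rewrite (mpolyE p).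
apply: (big_ind P) => [|//|m _]; first by rewrite -mpolyC0; apply: PC.
rewrite -mul_mpolyC mpolyXE_id; apply: (PM _ _ (PC _)).
apply: (big_ind P) => [|//|i _]; first by rewrite -mpolyC1; apply: PC.
elim: (m i) => [|d IHd]; first by rewrite expr0 -mpolyC1; apply: PC.
by rewrite exprS; apply: PM.
Qed.

Definition prime_poly p : Prop :=
  ~ principal p 1 /\
  forall q r, principal p (q * r) -> principal p q \/ principal p r.

Lemma principal_mull p q r : principal p q -> principal p (r * q).
Proof. by move=> [h ->]; exists (r * h); rewrite mulrA. Qed.

Lemma prime_poly_cancel p q r : prime_poly p -> ~ principal p q ->
  principal p (q * r) -> principal p r.
Proof. by move=> [_ pr_p] npq /pr_p[]. Qed.

Lemma prime_poly_exp p q m : prime_poly p -> principal p (q ^+ m) ->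
  principal p q.
Proof.
move=> [np1 pr_p]; elim: m => [/np1 //|m IHm].
by rewrite exprS => /pr_p[].
Qed.

Lemma prime_ndvd_mul p q r : prime_poly p -> ~ principal p q ->
  ~ principal p r -> ~ principal p (q * r).
Proof. by move=> [_ pr_p] nq nr /pr_p[]. Qed.

Lemma prime_poly_prod (I : Type) (l : seq I) (P : pred I) (F : I -> R) p :
    prime_poly p -> (forall i, P i -> ~ principal p (F i)) ->
  ~ principal p (\prod_(i <- l | P i) F i).
Proof.
move=> [np1 pr_p] npF.
apply: (big_ind (fun q => ~ principal p q)) => [//|q r npq npr|//].
by move=> /pr_p[].
Qed.

(** The step that replaces unique factorisation: a multiple h g of g that is
    divisible by a prime p not dividing g has p dividing h. *)
Lemma prime_poly_mul_dvd p g s : prime_poly p -> ~ principal p g ->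
  principal p s -> principal g s -> principal (p * g) s.
Proof.
move=> pr_p npg ps [h hE].
have [h' h'E] : principal p h.
  by apply: (prime_poly_cancel pr_p npg); rewrite mulrC -hE.
by exists h'; rewrite hE h'E mulrA.
Qed.

Lemma prime_poly_prod_dvd (I : eqType) (l : seq I) (F : I -> R) s :
    uniq l -> (forall i, prime_poly (F i)) ->
    (forall i j, i != j -> ~ principal (F i) (F j)) ->
    (forall i, principal (F i) s) ->
  principal (\prod_(i <- l) F i) s.
Proof.
move=> + pr_F nF sF; elim: l => [_|i l IHl /= /andP[il ul]].
  by exists s; rewrite big_nil mulr1.
rewrite big_cons; apply: prime_poly_mul_dvd => //; last exact: IHl.
rewrite big_seq_cond; apply: prime_poly_prod => // j /andP[jl _].
by apply: nF; apply: contraNneq il => ->.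
Qed.

Lemma prime_poly_kernel (S : idomainType) (phi : {rmorphism R -> S}) p :
  (forall q, phi q = 0 <-> principal p q) -> prime_poly p.
Proof.
move=> kerE; split=> [/kerE/eqP|q r /kerE]; first by rewrite rmorph1 oner_eq0.
by move/eqP; rewrite rmorphM mulf_eq0 => /orP[]/eqP/kerE; [left|right].
Qed.

(** The values lie in the field of fractions because the substituted element
    is a quotient b / a. *)
Definition subst_var (i : 'I_N) (e : {fraction R}) : R -> {fraction R} :=
  mmap (@FracField.tofrac R \o @mpolyC N k)
       (fun j => if j == i then e else ('X_j)%:F).

HB.instance Definition _ i e := GRing.RMorphism.on (subst_var i e).

Lemma subst_varX i e j :
  subst_var i e 'X_j = if j == i then e else ('X_j)%:F.
Proof. by rewrite /subst_var mmapX mmap1U. Qed.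

Lemma subst_varC i e c : subst_var i e c%:MP = (c%:MP)%:F.
Proof. by rewrite /subst_var mmapC. Qed.

(** Modulo a X_i - b the product a X_i is b, so a large enough power of a
    turns the substitution of b / a for X_i into an operation on polynomials.
    The property is stable under sums and products, hence holds for all p. *)
Lemma subst_var_reduce (i : 'I_N) (a b p : R) : a != 0 ->
  exists m, exists h, exists r,
    a ^+ m * p = h * (a * 'X_i - b) + r
      /\ (a ^+ m)%:F * subst_var i (b%:F / a%:F) p = r%:F.
Proof.
move=> a0; have aF : a%:F != 0 by rewrite tofrac_eq0.
elim/mpoly_generated_ind: p => [c|j|p q|p q].
- by exists 0%N, 0, c%:MP; rewrite expr0 subst_varC tofrac1 mul0r add0r !mul1r.
- rewrite subst_varX; case: eqP => [->|_].
    exists 1%N, 1, b; rewrite expr1 mul1r subrK; split=> //.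
    by rewrite mulrC divfK.
  by exists 0%N, 0, 'X_j; rewrite expr0 tofrac1 mul0r add0r !mul1r.
- move=> [m1 [h1 [r1 [E1 F1]]]] [m2 [h2 [r2 [E2 F2]]]].
  exists (m1 + m2)%N, (a ^+ m2 * h1 + a ^+ m1 * h2).
  exists (a ^+ m2 * r1 + a ^+ m1 * r2); split.
    have -> : a ^+ (m1 + m2) * (p + q)
        = a ^+ m2 * (a ^+ m1 * p) + a ^+ m1 * (a ^+ m2 * q).
      by rewrite exprD; ring.
    by rewrite E1 E2; ring.
  rewrite rmorphD exprD !tofracD !tofracM -F1 -F2; ring.
- move=> [m1 [h1 [r1 [E1 F1]]]] [m2 [h2 [r2 [E2 F2]]]].
  exists (m1 + m2)%N, (h1 * (a ^+ m2 * q) + r1 * h2), (r1 * r2); split.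
    have -> : a ^+ (m1 + m2) * (p * q) = (a ^+ m1 * p) * (a ^+ m2 * q).
      by rewrite exprD; ring.
    by rewrite E1 E2; ring.
  by rewrite rmorphM exprD !tofracM -F1 -F2; ring.
Qed.

(** If p is sent to 0 then the remainder of [subst_var_reduce] vanishes, and
    a^m p is a multiple of a X_i - b; the last hypothesis removes the powers
    of a. The hypotheses on phi a and phi b express that a and b do not
    involve X_i. *)
Lemma subst_var_kernel (i : 'I_N) (a b p : R) :
    let phi := subst_var i (b%:F / a%:F) in
    a != 0 -> phi a = a%:F -> phi b = b%:F ->
    (forall s, principal (a * 'X_i - b) (a * s) ->
       principal (a * 'X_i - b) s) ->
  phi p = 0 <-> principal (a * 'X_i - b) p.
Proof.
move=> phi a0 pa pb cancel_a; split=> [p0|[h ->]]; last first.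
  rewrite /phi in pa pb *; rewrite !(rmorphM, rmorphB) /= pa pb subst_varX.
  rewrite eqxx mulrCA divff ?mulr1.
    by rewrite subrr mulr0.
  by rewrite tofrac_eq0.
have [m [h [r [E F]]]] := subst_var_reduce i b p a0.
have r0 : r = 0 by apply/eqP; rewrite -tofrac_eq0 -F [subst_var _ _ _]p0 mulr0.
have: principal (a * 'X_i - b) (a ^+ m * p) by exists h; rewrite E r0 addr0.
elim: m {E F} => [|m IHm]; first by rewrite expr0 mul1r.
by rewrite exprS -mulrA => /cancel_a.
Qed.

Lemma mpolyX_neq0 i : 'X_i != 0 :> R.
Proof.
apply/eqP => /(congr1 (mcoeff U_(i))) /eqP.
by rewrite mcoeffXU eqxx mcoeff0 oner_eq0.
Qed.

Lemma variable_kernel i p : subst_var i 0 p = 0 <-> principal 'X_i p.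
Proof.
have := @subst_var_kernel i 1 0 p.
rewrite /= tofrac0 mul0r mul1r subr0; apply.
- exact: oner_neq0.
- by rewrite rmorph1 tofrac1.
- by rewrite rmorph0.
- by move=> s; rewrite mul1r.
Qed.

Lemma variable_prime i : prime_poly 'X_i.
Proof. exact: (prime_poly_kernel (variable_kernel i)). Qed.

Lemma derivation0 D : is_derivation D -> D 0 = 0.
Proof.
move=> [linD _]; have := linD 1 0 0; rewrite !scale1r addr0 => E.
by apply: (@addIr _ (D 0)); rewrite add0r -E.
Qed.

Lemma derivationD D p q : is_derivation D -> D (p + q) = D p + D q.
Proof. by move=> [linD _]; have := linD 1 p q; rewrite !scale1r. Qed.

Lemma derivationN D p : is_derivation D -> D (- p) = - D p.
Proof.
move=> dD; apply/eqP.
by rewrite -addr_eq0 -derivationD // addNr derivation0.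
Qed.

Lemma derivation1 D : is_derivation D -> D 1 = 0.
Proof.
move=> [_ mulD]; have := mulD 1 1; rewrite !mul1r mulr1 => E.
by apply: (@addIr _ (D 1)); rewrite add0r -E.
Qed.

Lemma derivationC D c : is_derivation D -> D c%:MP = 0.
Proof.
move=> dD; have [linD _] := dD; have := linD c 1 0.
by rewrite (derivation0 dD) (derivation1 dD) scaler0 !addr0 -mul_mpolyC mulr1.
Qed.

Lemma derivation_ext D1 D2 : is_derivation D1 -> is_derivation D2 ->
  (forall i, D1 'X_i = D2 'X_i) -> D1 = D2.
Proof.
move=> dD1 dD2 eqX; apply/funext => p.
elim/mpoly_generated_ind: p => [c|//|p q E1 E2|p q E1 E2].
- by rewrite !derivationC.
- by rewrite !derivationD // E1 E2.
- by rewrite dD1.2 dD2.2 E1 E2.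
Qed.

Lemma derivation_of_is_derivation (g : 'cV[R]_N) :
  is_derivation (derivation_of g).
Proof.
split=> [a p q|p q]; rewrite /derivation_of.
  rewrite scaler_sumr -big_split /=; apply: eq_bigr => i _.
  by rewrite linearP mulrDr -scalerAr.
rewrite mulr_suml mulr_sumr -big_split /=; apply: eq_bigr => i _.
by rewrite mderivM; ring.
Qed.

Lemma derivation_ofX (g : 'cV[R]_N) i : derivation_of g 'X_i = g i 0.
Proof.
rewrite /derivation_of (bigD1 i) //= big1 => [|j ji].
  rewrite mderivX mnm1E eqxx scale1r.
  by rewrite -{1}[U_(i)%MM]add0m addmK mpolyX0 mulr1 addr0.
by rewrite mderivX mnm1E eq_sym (negbTE ji) scale0r mulr0.
Qed.

Lemma derivation_ofE D : is_derivation D ->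
  derivation_of (\col_i (D 'X_i : R)) = D.
Proof.
move=> dD; apply: derivation_ext => // [|i].
  exact: derivation_of_is_derivation.
by rewrite derivation_ofX mxE.
Qed.

Lemma derivation_of0 : derivation_of (0 : 'cV[R]_N) = 0.
Proof.
by apply/funext => p; rewrite /derivation_of big1 // => i _; rewrite mxE mul0r.
Qed.

Lemma derivation_ofD (g h : 'cV[R]_N) :
  derivation_of (g + h) = derivation_of g + derivation_of h.
Proof.
apply/funext => p; rewrite /derivation_of -[RHS]big_split /=.
by apply: eq_bigr => i _; rewrite mxE mulrDl.
Qed.

Lemma derivation_ofZ (a : R) (g : 'cV[R]_N) :
  derivation_of (a *: g) = a *: derivation_of g.
Proof.
apply/funext => p; rewrite /derivation_of [RHS]mulr_sumr.
by apply: eq_bigr => i _; rewrite mxE mulrA.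
Qed.

Lemma derivation_of_mulmx (r : nat) (B : 'M[R]_(N, r)) (c : 'cV[R]_r) :
  derivation_of (B *m c) = \sum_j c j 0 *: derivation_of (col j B).
Proof.
have -> : B *m c = \sum_j c j 0 *: col j B.
  apply/matrixP => i l; rewrite ord1 mxE summxE; apply: eq_bigr => j _.
  by rewrite !mxE mulrC.
rewrite (big_morph _ derivation_ofD derivation_of0).
by apply: eq_bigr => j _; rewrite derivation_ofZ.
Qed.

(** The coefficients of a derivation are its values at the variables. *)
Lemma derivation_of_inj : injective (@derivation_of k N).
Proof.
by move=> g h E; apply/matrixP => i j; rewrite ord1 -!derivation_ofX E.
Qed.

Lemma gradient_mul_eq0 p (g : 'cV[R]_N) :
  gradient p *m g = 0 <-> derivation_of g p = 0.
Proof.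
have E : (gradient p *m g) 0 0 = derivation_of g p.
  by rewrite mxE; apply: eq_bigr => i _; rewrite mxE mulrC.
split=> [g0|g0]; first by rewrite -E g0 mxE.
by apply/matrixP => i j; rewrite !ord1 E g0 mxE.
Qed.

Lemma derivation_eigenM D p q a b : is_derivation D ->
  D p = a * p -> D q = b * q -> D (p * q) = (a + b) * (p * q).
Proof. by move=> [_ mulD] E1 E2; rewrite mulD E1 E2; ring. Qed.

Lemma derivation_eigen_prod D (I : Type) (l : seq I) (F c : I -> R) :
    is_derivation D -> (forall i, D (F i) = c i * F i) ->
  D (\prod_(i <- l) F i) = (\sum_(i <- l) c i) * \prod_(i <- l) F i.
Proof.
move=> dD DF; elim: l => [|i l IHl].
  by rewrite !big_nil derivation1 // mul0r.
by rewrite !big_cons; apply: derivation_eigenM.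
Qed.

(** From D (p g) = D p g + p D g, divisibility of D (p g) by p gives that p
    divides D p g, hence D p. *)
Lemma log_derivation_prime_factor D p g : is_derivation D ->
    prime_poly p -> ~ principal p g -> principal (p * g) (D (p * g)) ->
  principal p (D p).
Proof.
move=> [_ mulD] pr_p npg [h]; rewrite mulD => E.
apply: (prime_poly_cancel pr_p npg); exists (h * g - D g).
have -> : g * D p = (D p * g + p * D g) - p * D g by ring.
by rewrite E; ring.
Qed.

Lemma mpolyX_homog i : ('X_i : R) \is 1.-homog.
Proof. by rewrite dhomogX; apply/eqP/mdeg1. Qed.

Lemma dhomog_mcoeff0 d (p : R) : (0 < d)%N -> p \is d.-homog -> p@_0%MM = 0.
Proof.
by move=> d0 hp; apply: (dhomog_nemf_coeff hp); rewrite mf0 eq_sym -lt0n.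
Qed.

Lemma dhomog_mderiv p d i : p \is d.-homog -> p^`M(i) \is d.-1.-homog.
Proof.
move=> /dhomogP hp; apply/dhomogP => m; rewrite mcoeff_msupp mcoeff_deriv => nz.
have /hp : (m + U_(i))%MM \in msupp p.
  by rewrite mcoeff_msupp; apply: contraNneq nz => ->; rewrite mul0rn.
by move=> /= <-; rewrite mdegD mdeg1 addn1.
Qed.

Lemma pihomog_mul_homog d e p q : p \is e.-homog ->
  pihomog mdeg (d + e)%N (q * p) = pihomog mdeg d q * p.
Proof.
move=> hp; pose M := maxn (mmeasure mdeg q) d.+1.
rewrite {1}(pihomog_partitionE (leq_maxl (mmeasure mdeg q) d.+1)) -/M.
have dM : (d < M)%N by exact: leq_maxr.
rewrite mulr_suml linear_sum /= (bigD1 (Ordinal dM)) //= big1 ?addr0.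
  by rewrite pihomog_dE // dhomogM // pihomogP.
move=> j jd; apply: (@pihomog_ne0 _ _ mdeg (j + e)%N); last first.
  by rewrite dhomogM // pihomogP.
by rewrite eqn_add2r; apply: contraNneq jd => jd; apply/eqP/val_inj.
Qed.

(** Taking the component of degree d of c commutes with multiplication by B, so
    that component is mapped to B c as well; injectivity of B identifies it
    with c. *)
Lemma homog_preimage (r d e : nat) (B : 'M[R]_(N, r)) (c : 'cV[R]_r) :
    (forall i j, B i j \is e.-homog) ->
    (forall c' : 'cV[R]_r, B *m c' = 0 -> c' = 0) ->
    (forall i, (B *m c) i 0 \is (d + e)%N.-homog) ->
  forall j, c j 0 \is d.-homog.
Proof.
move=> hB injB hv j; pose c' := map_mx (pihomog mdeg d) c.
suff E : c - c' = 0 by rewrite (subr0_eq E) mxE pihomogP.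
apply: injB; rewrite mulmxBr; apply/eqP; rewrite subr_eq0; apply/eqP/matrixP.
move=> i j0; rewrite ord1 -[LHS](pihomog_dE (hv i)) !mxE linear_sum /=.
apply: eq_bigr => l _.
by rewrite mulrC pihomog_mul_homog // mxE mulrC.
Qed.

End Polynomials.

(** * Bases and resolutions with two terms *)

Section FreeBases.
Variables (A : nzRingType) (V : lmodType A) (M : V -> Prop).
Variables (I : finType) (e : I -> V).

(** A basis element outside of S that was a combination of those in S would give
    a relation with coefficient -1 on it. *)
Lemma free_basis_minimally_generates :
  free_basis M e -> minimally_generates M e.
Proof.
move=> [gen indep]; split=> // S /properP[_ [j _ jS]] genS.
have /genS [c cE] : M (e j).
  apply/gen; exists (fun i => (i == j)%:R).
  rewrite (bigD1 j) ?inE //= eqxx scale1r big1 ?addr0 // => i /andP[_ ij].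
  by rewrite (negbTE ij) scale0r.
have := indep (fun i => (if i \in S then c i else 0) - (i == j)%:R).
have -> : \sum_i ((if i \in S then c i else 0) - (i == j)%:R) *: e i = 0.
  under eq_bigr do rewrite scalerBl.
  rewrite sumrB [X in _ - X](bigD1 j) //= eqxx scale1r.
  rewrite [X in _ - (_ + X)]big1 ?addr0 => [|i ij]; last first.
    by rewrite (negbTE ij) scale0r.
  rewrite cE; apply/eqP; rewrite subr_eq0; apply/eqP.
  rewrite [RHS]big_mkcond /=.
  by apply: eq_bigr => i _; case: ifP => // _; rewrite scale0r.
move/(_ erefl j)/eqP.
by rewrite (negbTE jS) eqxx sub0r oppr_eq0 oner_eq0.
Qed.

End FreeBases.

Lemma sum_setT (V : nmodType) (I : finType) (F : I -> V) :
  \sum_(i in [set: I]) F i = \sum_i F i.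
Proof. by apply: eq_bigl => i; rewrite in_setT. Qed.

Lemma sum_option (V : nmodType) (I : finType) (F : option I -> V) :
  \sum_o F o = \sum_i F (Some i) + F None.
Proof.
rewrite addrC (bigD1 None) //=; congr (_ + _).
rewrite (reindex_omap Some id) => [|[i|]] //=.
by apply: eq_bigl => i; rewrite eqxx.
Qed.

Section LengthOneComplexes.
Variables (k : fieldType) (N : nat).
Local Notation R := {mpoly k[N]}.

Variables (r0 r1 : nat) (s0 s1 : int) (A : 'M[R]_(r0, r1)).

Definition length_one_rank i : nat :=
  match i with 0 => r0 | 1 => r1 | _ => 0 end.

Definition length_one_complex : free_complex k N := @FreeComplex k N
  length_one_rank (fun i _ => if i is 0 then s0 else s1)
  (fun i => match i return 'M[R]_(length_one_rank i, length_one_rank i.+1) with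
            | 0 => A | _ => 0 end).

(** A single injective matrix with homogeneous entries of positive degree is a
    minimal resolution of its cokernel: positivity of d.+1 is what makes the
    constant terms vanish. *)
Lemma length_one_resolution (E : graded_module k N) (d : nat)
    (e : 'I_r0 -> gm_ambient E) :
    (forall p, gm_num (e p)) -> (forall p, gm_deg s0 (e p)) ->
    (forall v, gm_num v -> exists c : 'cV[R]_r0,
       gm_den (v - \sum_p c p 0 *: e p)) ->
    (forall c : 'cV[R]_r0, gm_den (\sum_p c p 0 *: e p)
       <-> exists b, c = A *m b) ->
    (forall c : 'cV[R]_r1, A *m c = 0 -> c = 0) ->
    s1 - s0 = d.+1 -> (forall p q, A p q \is d.+1.-homog) ->
  @min_graded_free_resolution k N E length_one_complex e.
Proof.
move=> e_num e_deg e_surj e_ker injA sE homA; split=> //.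
- move=> [|i] c /=; last first.
    split=> _; last by rewrite mul0mx.
    by exists 0; apply/matrixP => -[j].
  split=> [/injA ->|[b ->]]; first by exists 0; rewrite mulmx0.
  by rewrite mul0mx mulmx0.
- move=> [|[|i]] /= p [q] // q_lt.
  by rewrite sE; apply: homA.
- move=> [|[|i]] /= p [q] // q_lt.
  exact: (dhomog_mcoeff0 (ltn0Sn d) (homA _ _)).
Qed.

End LengthOneComplexes.

(** * Rows and columns of psi *)

(** From here on n = m + 1, and t < m numbers the pairs of variables
    (x_(2 t + 1), x_(2 t + 2)). *)
Section Indices.
Variable m : nat.

Fact row_x_proof (t : 'I_m) : (2 * t < 2 * m.+1)%N.
Proof. by have := ltn_ord t; lia. Qed.

Fact row_y_proof (t : 'I_m) : (2 * t + 1 < 2 * m.+1)%N.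
Proof. by have := ltn_ord t; lia. Qed.

Fact row_w_proof : (2 * m < 2 * m.+1)%N. Proof. by lia. Qed.

Fact row_u_proof : (2 * m + 1 < 2 * m.+1)%N. Proof. by lia. Qed.

Fact col_even_proof (t : 'I_m) : (2 * t < (2 * m.+1).-1)%N.
Proof. by have := ltn_ord t; lia. Qed.

Fact col_odd_proof (t : 'I_m) : (2 * t + 1 < (2 * m.+1).-1)%N.
Proof. by have := ltn_ord t; lia. Qed.

Fact col_last_proof : (2 * m < (2 * m.+1).-1)%N. Proof. by lia. Qed.

Definition row_x t := Ordinal (row_x_proof t).
Definition row_y t := Ordinal (row_y_proof t).
Definition row_w := Ordinal row_w_proof.
Definition row_u := Ordinal row_u_proof.
Definition col_even t := Ordinal (col_even_proof t).
Definition col_odd t := Ordinal (col_odd_proof t).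
Definition col_last := Ordinal col_last_proof.

Section Sums.
Variable V : nmodType.

(** Sums over ordinals are moved to sums over natural numbers, where the bound
    can be rewritten without changing the type of the summand. *)
Lemma sum_ord_nat K (F : 'I_K -> V) :
  {G : nat -> V | (forall i : 'I_K, G i = F i)
                & \sum_i F i = \sum_(0 <= j < K) G j}.
Proof.
exists (fun j => oapp F 0 (insub j)) => [i|]; first by rewrite valK.
by rewrite big_mkord; apply: eq_bigr => i _; rewrite valK.
Qed.

Lemma sum_nat_pairs (G : nat -> V) :
  \sum_(0 <= j < 2 * m) G j = \sum_(t < m) (G (2 * t)%N + G (2 * t + 1)%N).
Proof.
elim: m => [|l IHl]; first by rewrite muln0 big_geq // big_ord0.
rewrite mulnS big_ord_recr -IHl /= add2n 2?big_nat_recr //= -addrA.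
by rewrite addn1.
Qed.

Lemma sum_rows (F : 'I_(2 * m.+1) -> V) :
  \sum_i F i = \sum_t (F (row_x t) + F (row_y t)) + (F row_w + F row_u).
Proof.
have [G GF ->] := sum_ord_nat F.
have -> : (2 * m.+1 = (2 * m).+2)%N by lia.
rewrite 2?big_nat_recr //= sum_nat_pairs -addrA -!GF /= addn1.
by congr (_ + _); apply: eq_bigr => t _; rewrite -!GF.
Qed.

Lemma sum_cols (F : 'I_(2 * m.+1).-1 -> V) :
  \sum_i F i = \sum_t (F (col_even t) + F (col_odd t)) + F col_last.
Proof.
have [G GF ->] := sum_ord_nat F.
have -> : ((2 * m.+1).-1 = (2 * m).+1)%N by lia.
rewrite big_nat_recr //= sum_nat_pairs -!GF /=.
by congr (_ + _); apply: eq_bigr => t _; rewrite -!GF.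
Qed.

End Sums.

Lemma row_cases (P : 'I_(2 * m.+1) -> Prop) :
    (forall t, P (row_x t)) -> (forall t, P (row_y t)) -> P row_w -> P row_u ->
  forall i, P i.
Proof.
move=> Px Py Pw Pu i.
have [im|im] := ltnP i (2 * m).
  have tP : (i./2 < m)%N by lia.
  have [oi|ei] := boolP (odd i).
    have -> : i = row_y (Ordinal tP) by apply: val_inj => /=; lia.
    exact: Py.
  have -> : i = row_x (Ordinal tP) by apply: val_inj => /=; lia.
  exact: Px.
have [oi|ei] := boolP (odd i).
  have -> : i = row_u by apply: val_inj => /=; have := ltn_ord i; lia.
  exact: Pu.
have -> : i = row_w by apply: val_inj => /=; have := ltn_ord i; lia.
exact: Pw.
Qed.

Lemma col_cases (P : 'I_(2 * m.+1).-1 -> Prop) :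
    (forall t, P (col_even t)) -> (forall t, P (col_odd t)) -> P col_last ->
  forall i, P i.
Proof.
move=> Px Py Pl i.
have [im|im] := ltnP i (2 * m).
  have tP : (i./2 < m)%N by lia.
  have [oi|ei] := boolP (odd i).
    have -> : i = col_odd (Ordinal tP).
      by apply/val_inj; change (i = 2 * i./2 + 1 :> nat)%N; lia.
    exact: Py.
  have -> : i = col_even (Ordinal tP).
    by apply/val_inj; change (i = 2 * i./2 :> nat)%N; lia.
  exact: Px.
have ltim : (i < 2 * m + 1)%N by apply: leq_trans (ltn_ord i) _; lia.
have -> : i = col_last by apply/val_inj; change (i = 2 * m :> nat)%N; lia.
exact: Pl.
Qed.

Lemma row_index_eqE :
  ((forall s t : 'I_m, (row_x s == row_x t) = (s == t))
  * (forall s t : 'I_m, (row_y s == row_y t) = (s == t))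
  * (forall s t : 'I_m, (row_x s == row_y t) = false)
  * (forall s t : 'I_m, (row_y s == row_x t) = false)
  * (forall t : 'I_m, (row_x t == row_w) = false)
  * (forall t : 'I_m, (row_w == row_x t) = false)
  * (forall t : 'I_m, (row_y t == row_w) = false)
  * (forall t : 'I_m, (row_w == row_y t) = false)
  * (forall t : 'I_m, (row_x t == row_u) = false)
  * (forall t : 'I_m, (row_u == row_x t) = false)
  * (forall t : 'I_m, (row_y t == row_u) = false)
  * (forall t : 'I_m, (row_u == row_y t) = false)
  * ((row_u == row_w) = false) * ((row_w == row_u) = false))%type.
Proof.
by do !split; move=> *; rewrite -!(inj_eq val_inj) /=;
   repeat match goal with t : 'I_m |- _ =>
     have := ltn_ord t; generalize (nat_of_ord t); clear t end; lia.
Qed.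

End Indices.

Section LogarithmicDerivations.
Variables (k : fieldType) (m : nat).
Local Notation N := (2 * m.+1)%N.
Local Notation R := {mpoly k[N]}.
Local Notation f := (fpoly k m.+1).
Local Notation psi := (psi k m.+1).

Definition pair_x (t : 'I_m) : R := 'X_(row_x t).
Definition pair_y (t : 'I_m) : R := 'X_(row_y t).
Definition var_w : R := 'X_(row_w m).
Definition var_u : R := 'X_(row_u m).
Definition pair_minor (t : 'I_m) : R :=
  pair_x t * var_u - pair_y t * var_w.

Local Notation X := pair_x.
Local Notation Y := pair_y.
Local Notation W := var_w.
Local Notation U := var_u.
Local Notation Q := pair_minor.

Lemma XvarE (i : 'I_N) : Xvar k m.+1 i = 'X_i.
Proof. by rewrite /Xvar valK. Qed.

Lemma wvarE : wvar k m.+1 = W.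
Proof.
rewrite /wvar /var_w -XvarE; congr Xvar; rewrite /=; lia.
Qed.

Lemma uvarE : uvar k m.+1 = U.
Proof.
rewrite /uvar /var_u -XvarE; congr Xvar; rewrite /=; lia.
Qed.

Lemma fpolyE : f = W * U * \prod_t Q t.
Proof.
rewrite /fpoly /qpoly wvarE uvarE; congr (_ * _).
rewrite big_add1 big_mkord; apply: eq_bigr => t _.
rewrite /xvar /pair_minor /pair_x /pair_y -!XvarE.
by congr (Xvar _ _ _ * _ - Xvar _ _ _ * _); rewrite /=; lia.
Qed.

Lemma psi_x_even t s : psi (row_x t) (col_even s) = if s == t then W else 0.
Proof.
rewrite mxE wvarE /= -(inj_eq val_inj) /=.
have := ltn_ord t; have := ltn_ord s => ??.
by repeat case: ifP => //; lia.
Qed.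

Lemma psi_y_even t s : psi (row_y t) (col_even s) = if s == t then U else 0.
Proof.
rewrite mxE wvarE uvarE /= -(inj_eq val_inj) /=.
have := ltn_ord t; have := ltn_ord s => ??.
by repeat case: ifP => //; lia.
Qed.

Lemma psi_w_even s : psi (row_w m) (col_even s) = 0.
Proof.
rewrite mxE /=; have := ltn_ord s => ?.
by repeat case: ifP => //; lia.
Qed.

Lemma psi_u_even s : psi (row_u m) (col_even s) = 0.
Proof.
rewrite mxE /=; have := ltn_ord s => ?.
by repeat case: ifP => //; lia.
Qed.

Lemma psi_x_odd t s :
  psi (row_x t) (col_odd s) = if s == t then m.+2%:R * X t else 0.
Proof.
rewrite mxE /= -(inj_eq val_inj) /=.
have := ltn_ord t; have := ltn_ord s => ??.
by repeat case: ifP => //; lia.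
Qed.

Lemma psi_y_odd t s :
  psi (row_y t) (col_odd s) = if s == t then m.+2%:R * Y t else 0.
Proof.
rewrite mxE /= -(inj_eq val_inj) /=.
have := ltn_ord t; have := ltn_ord s => ??.
by repeat case: ifP => //; lia.
Qed.

Lemma psi_w_odd s : psi (row_w m) (col_odd s) = - W.
Proof.
rewrite mxE /=; have := ltn_ord s => ?.
by repeat case: ifP => //; lia.
Qed.

Lemma psi_u_odd s : psi (row_u m) (col_odd s) = - U.
Proof.
rewrite mxE /=; have := ltn_ord s => ?.
by repeat case: ifP => //; lia.
Qed.

Lemma psi_x_last t : psi (row_x t) (col_last m) = 0.
Proof.
rewrite mxE /=; have := ltn_ord t => ?.
by repeat case: ifP => //; lia.
Qed.

Lemma psi_y_last t : psi (row_y t) (col_last m) = m.+2%:R * Y t.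
Proof.
rewrite mxE /=; have := ltn_ord t => ?.
by repeat case: ifP => //; lia.
Qed.

Lemma psi_w_last : psi (row_w m) (col_last m) = - (m.+1%:R * W).
Proof. by rewrite mxE wvarE /=; repeat case: ifP => //; lia. Qed.

Lemma psi_u_last : psi (row_u m) (col_last m) = U.
Proof. by rewrite mxE uvarE /=; repeat case: ifP => //; lia. Qed.

Lemma psi_mul_x (c : 'cV[R]_N.-1) t : (psi *m c) (row_x t) 0 =
  c (col_even t) 0 * W + m.+2%:R * c (col_odd t) 0 * X t.
Proof.
rewrite mxE sum_cols psi_x_last mul0r addr0 (bigD1 t) //= big1 => [|s st].
  by rewrite psi_x_even psi_x_odd eqxx; ring.
by rewrite psi_x_even psi_x_odd (negbTE st); ring.
Qed.

Lemma psi_mul_y (c : 'cV[R]_N.-1) t : (psi *m c) (row_y t) 0 =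
  c (col_even t) 0 * U + m.+2%:R * (c (col_odd t) 0 + c (col_last m) 0) * Y t.
Proof.
rewrite mxE sum_cols psi_y_last (bigD1 t) //= big1 => [|s st].
  by rewrite psi_y_even psi_y_odd eqxx; ring.
by rewrite psi_y_even psi_y_odd (negbTE st); ring.
Qed.

Lemma psi_mul_w (c : 'cV[R]_N.-1) : (psi *m c) (row_w m) 0 =
  - (\sum_t c (col_odd t) 0 + m.+1%:R * c (col_last m) 0) * W.
Proof.
rewrite mxE sum_cols psi_w_last.
rewrite (eq_bigr (fun t => - W * c (col_odd t) 0)) => [|t _].
  by rewrite -mulr_sumr; ring.
by rewrite psi_w_even psi_w_odd; ring.
Qed.

Lemma psi_mul_u (c : 'cV[R]_N.-1) : (psi *m c) (row_u m) 0 =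
  (c (col_last m) 0 - \sum_t c (col_odd t) 0) * U.
Proof.
rewrite mxE sum_cols psi_u_last.
rewrite (eq_bigr (fun t => - U * c (col_odd t) 0)) => [|t _].
  by rewrite -mulr_sumr; ring.
by rewrite psi_u_even psi_u_odd; ring.
Qed.

(** * The prime factors of f *)

Lemma W_ndvd_U : ~ principal W U.
Proof.
move=> /variable_kernel/eqP.
by rewrite subst_varX row_index_eqE tofrac_eq0 (negbTE (mpolyX_neq0 _ _)).
Qed.

Lemma U_ndvd_W : ~ principal U W.
Proof.
move=> /variable_kernel/eqP.
by rewrite subst_varX row_index_eqE tofrac_eq0 (negbTE (mpolyX_neq0 _ _)).
Qed.

Lemma W_ndvd_Q t : ~ principal W (Q t).
Proof.
move=> /variable_kernel/eqP.
rewrite rmorphB !rmorphM /= !subst_varX !row_index_eqE eqxx mulr0 subr0.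
by rewrite mulf_eq0 !tofrac_eq0 !(negbTE (mpolyX_neq0 _ _)).
Qed.

Lemma U_ndvd_Q t : ~ principal U (Q t).
Proof.
move=> /variable_kernel/eqP.
rewrite rmorphB !rmorphM /= !subst_varX !row_index_eqE eqxx mulr0 sub0r.
by rewrite oppr_eq0 mulf_eq0 !tofrac_eq0 !(negbTE (mpolyX_neq0 _ _)).
Qed.

Lemma Q_neq0 t : Q t != 0.
Proof.
by apply/eqP => Q0; apply: (@U_ndvd_Q t); exists 0; rewrite Q0 mul0r.
Qed.

(** Here a = u and b = y_t w. To cancel u in u s = h q_t, note that the prime u
    divides h, as it does not divide q_t. *)
Lemma Q_kernel t p :
  subst_var (row_x t) ((Y t * W)%:F / U%:F) p = 0 <-> principal (Q t) p.
Proof.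
rewrite /pair_minor (mulrC (X t)); apply: subst_var_kernel.
- exact: mpolyX_neq0.
- by rewrite subst_varX row_index_eqE.
- by rewrite rmorphM /= !subst_varX !row_index_eqE tofracM.
move=> s; rewrite -[U * _](mulrC (X t)) -/(Q t) => -[h E].
have [h' h'E] : principal U h.
  apply: (prime_poly_cancel (variable_prime _ _) (@U_ndvd_Q t)).
  by exists s; rewrite mulrC -E mulrC.
exists h'; apply: (mulfI (mpolyX_neq0 k (row_u m))).
by rewrite [LHS]E h'E /var_u; ring.
Qed.

Lemma Q_prime t : prime_poly (Q t).
Proof. exact: (prime_poly_kernel (Q_kernel t)). Qed.

Lemma Q_ndvd_W t : ~ principal (Q t) W.
Proof.
move=> /Q_kernel/eqP.
by rewrite subst_varX row_index_eqE tofrac_eq0 (negbTE (mpolyX_neq0 _ _)).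
Qed.

Lemma Q_ndvd_U t : ~ principal (Q t) U.
Proof.
move=> /Q_kernel/eqP.
by rewrite subst_varX row_index_eqE tofrac_eq0 (negbTE (mpolyX_neq0 _ _)).
Qed.

Lemma Q_ndvd_Q s t : s != t -> ~ principal (Q s) (Q t).
Proof.
move=> st /Q_kernel/eqP; rewrite rmorphB !rmorphM /= !subst_varX !row_index_eqE.
rewrite (eq_sym t) (negbTE st) -!tofracM -tofracB tofrac_eq0.
exact/negP/Q_neq0.
Qed.

Lemma fpoly_neq0 : f != 0.
Proof.
rewrite fpolyE !mulf_neq0 ?mpolyX_neq0 //.
by apply/prodf_neq0 => t _; apply: Q_neq0.
Qed.

Lemma W_ndvd_cofactor : ~ principal W (U * \prod_t Q t).
Proof.
apply: prime_ndvd_mul; [exact: variable_prime|exact: W_ndvd_U|].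
by apply: prime_poly_prod => [|t _]; [apply: variable_prime|apply: W_ndvd_Q].
Qed.

Lemma U_ndvd_prod_Q : ~ principal U (\prod_t Q t).
Proof.
by apply: prime_poly_prod => [|t _]; [apply: variable_prime|apply: U_ndvd_Q].
Qed.

Lemma fpoly_dvd (s : R) : principal W s -> principal U s ->
  (forall t, principal (Q t) s) -> principal f s.
Proof.
move=> Ws Us Qs; rewrite fpolyE -mulrA.
apply: prime_poly_mul_dvd => //; first exact: variable_prime.
  exact: W_ndvd_cofactor.
apply: prime_poly_mul_dvd => //; first exact: variable_prime.
  exact: U_ndvd_prod_Q.
apply: prime_poly_prod_dvd => //; first exact: index_enum_uniq.
- exact: Q_prime.
- by move=> s' t; apply: Q_ndvd_Q.
Qed.

Lemma fpoly_factor_Q t : f = Q t * (W * U * \prod_(s | s != t) Q s).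
Proof. by rewrite fpolyE (bigD1 t) //=; ring. Qed.

Lemma W_dvd_fpoly : principal W f.
Proof. by exists (U * \prod_t Q t); rewrite fpolyE; ring. Qed.

Lemma U_dvd_fpoly : principal U f.
Proof. by exists (W * \prod_t Q t); rewrite fpolyE; ring. Qed.

Lemma Q_dvd_fpoly t : principal (Q t) f.
Proof.
by exists (W * U * \prod_(s | s != t) Q s); rewrite mulrC -fpoly_factor_Q.
Qed.

(** This is reducedness of f: each prime factor of f divides s. *)
Lemma fpoly_radical (s : R) e : principal f (s ^+ e) -> principal f s.
Proof.
have tr (p : R) : prime_poly p -> principal p f -> principal f (s ^+ e) ->
    principal p s.
  move=> pr_p pf [h E]; apply: (prime_poly_exp (m := e) pr_p).
  by rewrite E; apply: principal_mull.
move=> fs; apply: fpoly_dvd => [||t]; apply: tr => //.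
- exact: variable_prime.
- exact: W_dvd_fpoly.
- exact: variable_prime.
- exact: U_dvd_fpoly.
- exact: Q_prime.
- exact: Q_dvd_fpoly.
Qed.

(** * Logarithmic derivations in coordinates *)

(** The function c records the eigenvalues of D on the factors q_t. *)
Record log_coordinates (D : R -> R^o) (a b : R) (c d : 'I_m -> R) : Prop :=
  LogCoordinates {
    lc_W : D W = a * W;
    lc_U : D U = b * U;
    lc_X : forall t, D (X t) = (c t - b) * X t + d t * W;
    lc_Y : forall t, D (Y t) = (c t - a) * Y t + d t * U
  }.

Lemma log_coordinates_fpoly D a b c d : is_derivation D ->
  log_coordinates D a b c d -> D f = (a + b + \sum_t c t) * f.
Proof.
move=> dD [DW DU DX DY]; rewrite fpolyE.
apply: (derivation_eigenM dD); first exact: derivation_eigenM.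
apply: derivation_eigen_prod => // t.
have [_ mulD] := dD.
by rewrite /pair_minor derivationD // derivationN // !mulD DW DU DX DY; ring.
Qed.

(** D preserves the ideals of w, u and q_t; comparing D q_t with c_t q_t then
    determines D on the pair (x_t, y_t) up to a multiple of (w, u). *)
Lemma log_coordinates_exist D : log_derivation f D ->
  exists a b c d, log_coordinates D a b c d.
Proof.
move=> [dD fD]; have [_ mulD] := dD.
have [a DW] : principal W (D W).
  apply: (@log_derivation_prime_factor _ _ _ _ (U * \prod_t Q t)) => //.
  - exact: variable_prime.
  - exact: W_ndvd_cofactor.
  - by rewrite mulrA -fpolyE.
have [b DU] : principal U (D U).
  apply: (@log_derivation_prime_factor _ _ _ _ (W * \prod_t Q t)) => //.
  - exact: variable_prime.
  - apply: prime_ndvd_mul; [exact: variable_prime|exact: U_ndvd_W|].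
    exact: U_ndvd_prod_Q.
  - by rewrite mulrCA mulrA -fpolyE.
have XY t : exists cd : R * R, D (X t) = (cd.1 - b) * X t + cd.2 * W
                            /\ D (Y t) = (cd.1 - a) * Y t + cd.2 * U.
  have [c DQ] : principal (Q t) (D (Q t)).
    apply: (@log_derivation_prime_factor _ _ _ _
      (W * U * \prod_(s | s != t) Q s)) => //.
    - exact: Q_prime.
    - apply: prime_ndvd_mul; first exact: Q_prime.
        by apply: prime_ndvd_mul; [apply: Q_prime|apply: Q_ndvd_W|
                                   apply: Q_ndvd_U].
      apply: prime_poly_prod => [|s st]; first exact: Q_prime.
      by apply: Q_ndvd_Q; rewrite eq_sym.
    - by rewrite -fpoly_factor_Q.
  (* D q_t = c q_t with the terms in u and in w on different sides. *)
  have E : U * (D (X t) + (b - c) * X t) = W * (D (Y t) + (a - c) * Y t).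
    move: DQ; rewrite /pair_minor derivationD // derivationN // !mulD DW DU.
    move=> DQ.
    apply/eqP; rewrite -subr_eq0; apply/eqP.
    transitivity ((D (X t) * U + X t * (b * U)
                    - (D (Y t) * W + Y t * (a * W)))
                  - c * (X t * U - Y t * W)); first by ring.
    by rewrite DQ subrr.
  have [d dE] : principal W (D (X t) + (b - c) * X t).
    apply: (prime_poly_cancel (variable_prime _ _) W_ndvd_U).
    by exists (D (Y t) + (a - c) * Y t); rewrite [LHS]E mulrC.
  exists (c, d) => /=; split.
    have -> : D (X t) = (D (X t) + (b - c) * X t) + (c - b) * X t by ring.
    by rewrite dE addrC.
  have dE' : D (Y t) + (a - c) * Y t = d * U.
    apply: (mulfI (mpolyX_neq0 k (row_w m))).
    by rewrite -[LHS]E dE /var_w; ring.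
  have -> : D (Y t) = (D (Y t) + (a - c) * Y t) + (c - a) * Y t by ring.
  by rewrite dE' addrC.
have [cd cdE] := fin_all_exists XY.
exists a, b, (fun t => (cd t).1), (fun t => (cd t).2).
by split=> // t; case: (cdE t).
Qed.

Definition euler_col : 'cV[R]_N := \col_i 'X_i.

(** The general element of the span of the columns of psi and of the Euler
    derivation, kept apart because e alone decides the value at f. *)
Definition combination (c : 'cV[R]_N.-1) (e : R) : 'cV[R]_N :=
  psi *m c + e *: euler_col.

Lemma combination_row c e i :
  combination c e i 0 = (psi *m c) i 0 + e * 'X_i.
Proof. by rewrite !mxE. Qed.

Lemma log_coordinates_combination (c : 'cV[R]_N.-1) (e : R) :
  let b := e - \sum_t c (col_odd t) 0 + c (col_last m) 0 in
  log_coordinates (derivation_of (combination c e))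
    (e - \sum_t c (col_odd t) 0 - m.+1%:R * c (col_last m) 0) b
    (fun t => m.+2%:R * c (col_odd t) 0 + e + b) (fun t => c (col_even t) 0).
Proof.
split=> [||t|t]; rewrite derivation_ofX combination_row
  ?psi_mul_w ?psi_mul_u ?psi_mul_x ?psi_mul_y;
  rewrite /var_w /var_u /pair_x /pair_y; ring.
Qed.

(** The contributions of c to a + b + \sum_t c_t cancel, that is, the columns
    of psi are syzygies. *)
Lemma combination_fpoly c e :
  derivation_of (combination c e) f = N%:R * e * f.
Proof.
rewrite (log_coordinates_fpoly (derivation_of_is_derivation _)
  (log_coordinates_combination c e)).
have sum_const (p : R) : \sum_(t < m) p = m%:R * p.
  by rewrite sumr_const card_ord mulr_natl.
by congr (_ * f); rewrite !big_split /= -mulr_sumr !sum_const natrM; ring.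
Qed.

Lemma col_of_coordinates (alpha d : 'I_m -> R) (beta : R) :
  exists c : 'cV[R]_N.-1, [/\ forall t, c (col_even t) 0 = d t,
    forall t, c (col_odd t) 0 = alpha t & c (col_last m) 0 = beta].
Proof.
exists (\col_j if insub j./2 is Some t then if odd j then alpha t else d t
               else beta).
split=> [t|t|]; rewrite mxE /=.
- have -> : (2 * t)./2 = t by lia.
  by rewrite valK; case: ifP => //; lia.
- have -> : (2 * t + 1)./2 = t by lia.
  by rewrite valK; case: ifP => //; lia.
- by rewrite insubN //; lia.
Qed.

Hypothesis char0 : [pchar k] =i pred0.

Lemma natr_dim : N%:R = (2 * m)%N.+2%:R :> R.
Proof.
have E : N = (2 * m)%N.+2 by lia.
exact (congr1 (fun j : nat => j%:R : R) E).
Qed.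

Lemma mpoly_natr_neq0 j : j.+1%:R != 0 :> R.
Proof.
rewrite -(rmorph_nat (@mpolyC N k)) mpolyC_eq0.
by have /pcharf0P -> := char0.
Qed.

Lemma mpoly_natr_inv j : exists i : R, i * j.+1%:R = 1.
Proof.
exists ((j.+1%:R)^-1)%:MP; rewrite -(rmorph_nat (@mpolyC N k)) -rmorphM /=.
by rewrite mulVf ?rmorph1 //; have /pcharf0P -> := char0.
Qed.

(** The coordinates of [log_coordinates_combination] are solved for the
    coefficients: the sum a + b + \sum_t c_t equals 2 n e, and then
    (n + 1) times the coefficients of the last and of the odd columns are
    b - a and c_t - b - e. *)
Lemma combination_of_coordinates D a b c d : is_derivation D ->
  log_coordinates D a b c d ->
  exists c' e, D = derivation_of (combination c' e).
Proof.
move=> dD [DW DU DX DY].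
(* i1 and i2 are the inverses of n + 1 and of 2 n. *)
have [i1 i1E] := mpoly_natr_inv m.+1.
have [i2 i2E] := mpoly_natr_inv (2 * m)%N.+1.
have i2E' : i2 * (2 * m.+1)%N%:R = 1 by rewrite natr_dim.
pose e := i2 * (a + b + \sum_t c t).
have eE : (2 * m.+1)%N%:R * e = a + b + \sum_t c t.
  by rewrite /e mulrA (mulrC _ i2) i2E' mul1r.
have [c' [c'x c'y c'l]] :=
  col_of_coordinates (fun t => i1 * (c t - b - e)) d (i1 * (b - a)).
have S : m.+2%:R * \sum_t c' (col_odd t) 0 = e * m.+2%:R - a - m.+1%:R * b.
  rewrite mulr_sumr (eq_bigr (fun t => c t + (- b - e))) => [|t _].
    rewrite big_split sumr_const card_ord /= -mulr_natr.
    have -> : \sum_t c t = (2 * m.+1)%N%:R * e - a - b by rewrite eE; ring.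
    by rewrite natrM; ring.
  by rewrite c'y mulrA (mulrC _ i1) i1E mul1r addrA.
have L : m.+2%:R * c' (col_last m) 0 = b - a.
  by rewrite c'l mulrA (mulrC _ i1) i1E mul1r.
have AL t : m.+2%:R * c' (col_odd t) 0 = c t - b - e.
  by rewrite c'y mulrA (mulrC _ i1) i1E mul1r.
exists c', e; apply: derivation_ext => //.
  exact: derivation_of_is_derivation.
apply: row_cases => [t|t||]; rewrite derivation_ofX combination_row.
- by rewrite psi_mul_x AL c'x [LHS]DX /pair_x; ring.
- by rewrite psi_mul_y mulrDr AL L c'x [LHS]DY /pair_y; ring.
- rewrite psi_mul_w [LHS]DW; apply: (mulfI (mpoly_natr_neq0 m.+1)).
  transitivity (- (m.+2%:R * \sum_t c' (col_odd t) 0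
    + m.+1%:R * (m.+2%:R * c' (col_last m) 0)) * W + m.+2%:R * e * W).
    by rewrite S L /var_w; ring.
  by rewrite /var_w; ring.
- rewrite psi_mul_u [LHS]DU; apply: (mulfI (mpoly_natr_neq0 m.+1)).
  transitivity ((m.+2%:R * c' (col_last m) 0
    - m.+2%:R * \sum_t c' (col_odd t) 0) * U + m.+2%:R * e * U).
    by rewrite S L /var_u; ring.
  by rewrite /var_u; ring.
Qed.

(** The rows of w and u give that the last coefficient is 0 and that e is the
    sum of the odd coefficients. Eliminating the even coefficient between the
    rows of x_t and y_t leaves a multiple of q_t, so (n + 1) times each odd
    coefficient is - e; summing over t gives 2 n e = 0. *)
Lemma combination_inj c e : combination c e = 0 -> c = 0 /\ e = 0.
Proof.
move=> /matrixP/(_ _ 0) E.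
have mulI (i : 'I_N) (p : R) : p * 'X_i = 0 -> p = 0.
  by move/eqP; rewrite mulf_eq0 (negbTE (mpolyX_neq0 _ _)) orbF => /eqP.
have Ew : e = \sum_t c (col_odd t) 0 + m.+1%:R * c (col_last m) 0.
  apply/eqP; rewrite -subr_eq0; apply/eqP/(mulI (row_w m)).
  have := E (row_w m); rewrite combination_row psi_mul_w mxE.
  by apply: etrans; rewrite /var_w; ring.
have Eu : e = \sum_t c (col_odd t) 0 - c (col_last m) 0.
  apply/eqP; rewrite -subr_eq0; apply/eqP/(mulI (row_u m)).
  have := E (row_u m); rewrite combination_row psi_mul_u mxE.
  by apply: etrans; rewrite /var_u; ring.
have L0 : c (col_last m) 0 = 0.
  apply: (mulfI (mpoly_natr_neq0 m.+1)); rewrite mulr0.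
  transitivity (e - e); last exact: subrr.
  by rewrite {1}Ew Eu; ring.
have S : e = \sum_t c (col_odd t) 0 by rewrite Eu L0 subr0.
have xy t : m.+2%:R * c (col_odd t) 0 + e = 0 /\ c (col_even t) 0 = 0.
  have Ex := E (row_x t); have Ey := E (row_y t).
  rewrite combination_row psi_mul_x mxE in Ex.
  rewrite combination_row psi_mul_y L0 addr0 mxE in Ey.
  have A0 : m.+2%:R * c (col_odd t) 0 + e = 0.
    apply: (mulIf (Q_neq0 t)); rewrite mul0r.
    transitivity (
        (c (col_even t) 0 * W + m.+2%:R * c (col_odd t) 0 * X t + e * X t) * U
      - (c (col_even t) 0 * U + m.+2%:R * c (col_odd t) 0 * Y t + e * Y t) * W).
      by rewrite /pair_minor; ring.
    by rewrite [X in X * U]Ex [X in X * W]Ey !mul0r subrr.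
  split=> //; apply: (mulI (row_w m)).
  transitivity (c (col_even t) 0 * W + m.+2%:R * c (col_odd t) 0 * X t + e * X t
     - (m.+2%:R * c (col_odd t) 0 + e) * X t); first by rewrite /var_w; ring.
  by rewrite [X in X - _]Ex A0 mul0r subrr.
have e0 : e = 0.
  apply: (mulfI (mpoly_natr_neq0 (2 * m)%N.+1)); rewrite mulr0.
  transitivity (\sum_t (m.+2%:R * c (col_odd t) 0 + e)).
    rewrite big_split /= -mulr_sumr -S sumr_const card_ord -mulr_natr.
    have -> : ((2 * m).+2 = m.+2 + m)%N by lia.
    by rewrite natrD; ring.
  by rewrite big1 // => t _; case: (xy t).
split=> //; apply/matrixP => j j0; rewrite ord1 mxE.
elim/col_cases: j => [t|t|//]; first by case: (xy t).
have [+ _] := xy t; rewrite e0 addr0 => /eqP.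
by rewrite mulf_eq0 (negbTE (mpoly_natr_neq0 _)) => /eqP.
Qed.

Lemma log_derivationP D : log_derivation f D <->
  exists c e, D = derivation_of (combination c e).
Proof.
split=> [logD|[c [e ->]]]; last first.
  split; first exact: derivation_of_is_derivation.
  by exists (N%:R * e); rewrite combination_fpoly.
have [a [b [c [d lc]]]] := log_coordinates_exist logD.
exact: combination_of_coordinates (proj1 logD) lc.
Qed.

(** A syzygy is a derivation that kills f, and [combination_fpoly] then forces
    e = 0. *)
Lemma syzygyP (v : 'cV[R]_N) :
  gradient f *m v = 0 <-> exists c, v = psi *m c.
Proof.
rewrite gradient_mul_eq0; split=> [Dv|[c ->]].
  have [c [e E]] :
      exists c e, derivation_of v = derivation_of (combination c e).
    apply/log_derivationP; split; first exact: derivation_of_is_derivation.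
    by exists 0; rewrite Dv mul0r.
  have vE : v = combination c e.
    exact: derivation_of_inj.
  have e0 : e = 0.
    apply: (mulfI (mpoly_natr_neq0 (2 * m)%N.+1)); rewrite mulr0.
    apply: (mulIf fpoly_neq0); rewrite mul0r -[RHS]Dv E combination_fpoly.
    by rewrite natr_dim.
  by exists c; rewrite vE e0 /combination scale0r addr0.
have -> : psi *m c = combination c 0 by rewrite /combination scale0r addr0.
by rewrite combination_fpoly mulr0 mul0r.
Qed.

End LogarithmicDerivations.

(** * The free basis and the two resolutions *)

Section Resolutions.
Variables (k : fieldType) (m : nat).
Local Notation N := (2 * m.+1)%N.
Local Notation R := {mpoly k[N]}.
Local Notation f := (fpoly k m.+1).
Local Notation psi := (psi k m.+1).

Lemma psi_homog i j : psi i j \is 1.-homog.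
Proof.
rewrite mxE wvarE uvarE !mulr_natl.
by repeat case: ifP => _;
  rewrite ?rpredN ?rpredMn ?rpred0 ?mpolyX_homog // dhomog0.
Qed.

Lemma fpoly_homog : f \is N.-homog.
Proof.
have homXX (i j : 'I_N) : ('X_i * 'X_j : R) \is 2.-homog.
  exact: dhomogM (mpolyX_homog _ i) (mpolyX_homog _ j).
have homQ (l : seq 'I_m) :
    \prod_(t <- l) pair_minor k t \is (2 * size l).-homog.
  elim: l => [|t l IHl]; first by rewrite big_nil muln0 dhomog1.
  rewrite big_cons (mulnS 2 (size l)); apply: dhomogM => //.
  by apply: rpredB; apply: homXX.
have := dhomogM (dhomogM (mpolyX_homog k (row_w m)) (mpolyX_homog k (row_u m)))
                (homQ (index_enum 'I_m)).
rewrite -fpolyE -[index_enum _]enumT size_enum_ord.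
by have -> : (1 + 1 + 2 * m = N)%N by lia.
Qed.

(** The coefficient matrix of the basis, as in Saito's criterion. *)
Definition saito_matrix : 'M[R]_(N, N.-1 + 1) := row_mx psi (euler_col k m).

Lemma saito_matrix_mul (c : 'cV[R]_(N.-1 + 1)) :
  saito_matrix *m c = combination (usubmx c) (dsubmx c 0 0).
Proof.
rewrite -{1}[c]vsubmxK mul_row_col; congr (_ + _).
by rewrite [X in _ *m X]mx11_scalar mul_mx_scalar.
Qed.

Lemma saito_matrix_homog i j : saito_matrix i j \is 1.-homog.
Proof.
rewrite -[j]splitK; case: (fintype.split j) => j' /=.
  by rewrite row_mxEl psi_homog.
by rewrite row_mxEr mxE mpolyX_homog.
Qed.

Lemma theta_euler_combination (c : 'cV[R]_N.-1) (e : R) :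
  derivation_of (combination c e)
  = \sum_j c j 0 *: theta j + e *: @euler_derivation k N.
Proof. by rewrite derivation_ofD derivation_ofZ derivation_of_mulmx. Qed.

Hypothesis char0 : [pchar k] =i pred0.

Lemma saito_matrix_inj (c : 'cV[R]_(N.-1 + 1)) :
  saito_matrix *m c = 0 -> c = 0.
Proof.
rewrite saito_matrix_mul => /(combination_inj char0)[c0 e0].
rewrite -[c]vsubmxK c0 [dsubmx c]mx11_scalar e0 rmorph0.
exact: col_mx0.
Qed.

Lemma log_derivation_saito D : log_derivation f D <->
  exists c, D = derivation_of (saito_matrix *m c).
Proof.
rewrite (log_derivationP char0); split=> [[c [e ->]]|[c ->]].
  exists (col_mx c e%:M); rewrite saito_matrix_mul col_mxKu col_mxKd.
  by rewrite mxE eqxx.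
by rewrite saito_matrix_mul; do 2!eexists.
Qed.

Lemma theta_euler_basis : free_basis (log_derivation f) (@theta_euler k m.+1).
Proof.
split=> [D|c].
  rewrite (log_derivationP char0); split=> [[c [e ->]]|[c ->]].
    exists (fun o => if o is Some j then c j 0 else e).
    by rewrite theta_euler_combination sum_setT sum_option.
  exists (\col_j c (Some j)), (c None).
  rewrite theta_euler_combination sum_setT sum_option.
  by congr (_ + _); apply: eq_bigr => j _; rewrite mxE.
rewrite sum_option => c0.
have /(combination_inj char0)[s0 e0] :
    combination (\col_j c (Some j)) (c None) = 0.
  apply: derivation_of_inj; rewrite derivation_of0 -[RHS]c0.
  rewrite theta_euler_combination.
  by congr (_ + _); apply: eq_bigr => j _; rewrite mxE.
by move=> [j|//]; have /matrixP/(_ j 0) := s0; rewrite !mxE.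
Qed.

Lemma psi_inj (c : 'cV[R]_N.-1) : psi *m c = 0 -> c = 0.
Proof.
move=> c0; have := @combination_inj k m char0 c 0.
by rewrite /combination scale0r addr0 => /(_ c0)[].
Qed.

Lemma psi_basis :
  free_basis (fun v : 'cV[R]_N => gradient f *m v = 0) (fun j => col j psi).
Proof.
have colE (c : 'I_N.-1 -> R) :
    \sum_j c j *: col j psi = psi *m (\col_j c j).
  apply/matrixP => i l; rewrite ord1 mxE summxE; apply: eq_bigr => j _.
  by rewrite !mxE mulrC.
split=> [v|c].
  rewrite (syzygyP char0); split=> [[c ->]|[c ->]].
    exists (fun j => c j 0); rewrite sum_setT.
    by rewrite colE; congr (_ *m _); apply/matrixP => j l; rewrite ord1 mxE.
  by exists (\col_j c j); rewrite -colE sum_setT.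
by rewrite colE => /psi_inj/matrixP c0 j; have := c0 j 0; rewrite !mxE.
Qed.

(** Linear independence of the partial derivatives: a relation with constant
    coefficients is a syzygy, hence has entries without constant term. *)
Lemma fpoly_admissible : admissible f.
Proof.
split.
- exact: fpoly_neq0.
- by exists N; apply: fpoly_homog.
- by move=> p e; apply: fpoly_radical.
- pose q : R := \prod_t pair_minor k t.
  exists (fun i j => if (i == row_w m) && (j == row_u m) then q else 0).
  rewrite (bigD1 (row_w m)) //= (bigD1 (row_u m)) //= !eqxx /= !big1 ?addr0.
  + by rewrite fpolyE mulrC.
  + by move=> i /negbTE iw; rewrite big1 // => j _; rewrite iw mul0r.
  + by move=> j /negbTE ->; rewrite mul0r.
- move=> c c0 i.
  have /(syzygyP char0)[b bE] : gradient f *m (\col_j (c j)%:MP) = 0.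
    apply/gradient_mul_eq0; rewrite -[RHS]c0; apply: eq_bigr => j _.
    by rewrite mxE mul_mpolyC.
  have /matrixP/(_ i 0) := bE; rewrite !mxE => /(congr1 (mcoeff 0%MM)).
  rewrite mcoeffC eqxx mulr1 => ->; rewrite raddf_sum big1 //= => j _.
  by rewrite rmorphM /= (@dhomog_mcoeff0 _ _ 1) ?mul0r ?psi_homog.
Qed.

Lemma fpoly_linearly_presented : linearly_presented_jacobian f.
Proof.
exists (@length_one_complex k N N N.-1 N.-1%:Z N%:Z psi).
exists (fun i => f^`M(i)).
split; last by case=> [|[]].
3: by [].
2: by split=> // j /=; lia.
apply: (@length_one_resolution _ _ _ _ _ _ _ (jacobian_module f) 0) => /=.
- move=> p; exists (fun i => (i == p)%:R); rewrite (bigD1 p) //= eqxx mul1r.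
  by rewrite big1 ?addr0 // => i /negbTE ->; rewrite mul0r.
- by move=> p; exact: dhomog_mderiv fpoly_homog.
- move=> v [c ->]; exists (\col_i c i); apply/eqP; rewrite subr_eq0; apply/eqP.
  by apply: eq_bigr => i _; rewrite mxE.
- by move=> c; rewrite -(syzygyP char0) gradient_mul_eq0.
- exact: psi_inj.
- lia.
- exact: psi_homog.
Qed.

(** The columns of M are the coordinates of the logarithmic derivations
    f d/dX_i; their degree follows from [homog_preimage], as f has degree 2 n and
    the entries of the Saito matrix have degree 1. *)
Lemma fpoly_adjugate : exists M : 'M[R]_(N.-1 + 1, N),
  saito_matrix *m M = f%:M /\ forall p q, M p q \is N.-1.-homog.
Proof.
have colM (i : 'I_N) : exists c, saito_matrix *m c = f *: delta_mx i (0 : 'I_1).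
  have [|c cE] :=
      (log_derivation_saito (derivation_of (f *: delta_mx i 0))).1.
    split; first exact: derivation_of_is_derivation.
    rewrite derivation_ofZ; exists (derivation_of (delta_mx i 0) f).
    exact: mulrC.
  by exists c; apply: derivation_of_inj.
have [c cE] := fin_all_exists colM.
exists (\matrix_(p, q) c q p 0); split.
  apply/matrixP => i j; have /matrixP/(_ i 0) := cE j.
  rewrite mxE [in X in _ = X -> _]mxE mxE eqxx andbT mulr_natr => E.
  rewrite mxE [RHS]mxE -E.
  by apply: eq_bigr => p _; rewrite mxE.
move=> p q; rewrite mxE.
apply: (homog_preimage (e := 1) saito_matrix_homog saito_matrix_inj) => i.
rewrite cE !mxE eqxx andbT addn1 mulr_natr rpredMn //.
exact: fpoly_homog.
Qed.

(** Under the identification of T(f) with a free module, f Der(R) is the image of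
    M; the two shifts 0 and 2 n - 1 contribute 0 and 2 n - 2. *)
Lemma fpoly_derivations_regularity :
  regularity_is (derivations_quotient f) (2 * (m.+1%:Z - 1)).
Proof.
have [M [BM homM]] := fpoly_adjugate.
have BMmul (b : 'cV[R]_N) : saito_matrix *m (M *m b) = f *: b.
  by rewrite mulmxA BM mul_scalar_mx.
exists (@length_one_complex k N (N.-1 + 1) N 0 N.-1 M).
exists (fun p => derivation_of (col p saito_matrix)).
split; last first.
- move=> [|[|i]] /= [j] //= _; lia.
- by exists 1%N, (row_w m) => /=; lia.
apply: (@length_one_resolution _ _ _ _ _ _ _ (derivations_quotient f) (2 * m))
  => /=.
- move=> p; apply/log_derivation_saito; exists (delta_mx p 0).
  by rewrite -colE.
- by move=> p i; rewrite derivation_ofX mxE; apply: saito_matrix_homog.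
- move=> D /log_derivation_saito[c ->]; exists c, (derivation_of 0).
    exact: derivation_of_is_derivation.
  by rewrite derivation_of_mulmx subrr derivation_of0 scaler0.
- move=> c; rewrite -derivation_of_mulmx; split=> [[D' dD']|[b ->]].
    rewrite -(derivation_ofE dD') -derivation_ofZ -BMmul.
    move/derivation_of_inj/eqP; rewrite -subr_eq0 -mulmxBr => /eqP.
    move/saito_matrix_inj/subr0_eq => ->.
    by eexists.
  exists (derivation_of b); first exact: derivation_of_is_derivation.
  by rewrite BMmul derivation_ofZ.
- move=> b Mb; apply/matrixP => i j.
  have /matrixP/(_ i j)/eqP := BMmul b; rewrite Mb mulmx0 !mxE eq_sym mulf_eq0.
  by rewrite (negbTE (fpoly_neq0 _ _)) => /eqP.
- lia.
- by move=> p q; have := homM p q; congr (is_true (_ \is _.-homog)); lia.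
Qed.

End Resolutions.

Theorem theorem3p1 (k : fieldType) (hk : [pchar k] =i pred0)
    (n : nat) (hn : (2 <= n)%N) :
  [/\ linear_free_divisor (fpoly k n),
      syzygy_matrix (gradient (fpoly k n)) (psi k n)
        /\ free_basis (log_derivation (fpoly k n)) (@theta_euler k n)
    & regularity_is (derivations_quotient (fpoly k n)) (2 * (n%:Z - 1))].
Proof.
case: n hn => [//|m] _; split; [split; [split|]|split|].
- exact: fpoly_admissible.
- by eexists; eexists; apply: theta_euler_basis.
- exact: fpoly_linearly_presented.
- exact/free_basis_minimally_generates/psi_basis.
- exact: theta_euler_basis.
- exact: fpoly_derivations_regularity.
Qed.
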